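(* Let $X$ be any vector space and let $Y$ be a compact topological space. For any linear functional $f$ on $X$ and any linear map $A\colon X\to C(Y)$, the following are equivalent: (a) There exists $\varepsilon>0$ such that $\|(A\xi)^-\|\ge\varepsilon$ for all $\xi\in X$ with $f(\xi)=-1$. (b) There exists a positive Radon measure $\mu$ on $Y$ such that $f(\xi)=\mu(A\xi)$ for all $\xi\in X$.
   Context: Vector spaces are real. $C(Y)$ is the Banach space of continuous real-valued functions on $Y$ with the sup norm $\|\cdot\|$. Its dual space $C^*(Y)$ is taken to consist of all signed Radon measures on $Y$, and $\mu(z)=\int_Y z\,d\mu$ for $z\in C(Y)$. Every $z\in C(Y)$ is decomposed into its positive and negative parts, $z=z^+-z^-$ with $z^+=\max(z,0)$ and $z^-=\max(-z,0)$. *)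

(* Defs.v *)
From HB Require Import structures.
From mathcomp Require Import all_boot all_order all_algebra.
From mathcomp Require Import all_classical all_reals all_analysis.

Set Implicit Arguments.
Unset Strict Implicit.
Unset Printing Implicit Defensive.

Import Order.TTheory GRing.Theory Num.Theory.
Import numFieldNormedType.Exports.

Local Open Scope classical_set_scope.
Local Open Scope ring_scope.

(* C(Y) is the library type [continuousType Y R]; we equip it with its
   pointwise vector space structure, as a submodule of Y -> R. *)
Section continuous_functions.
Variables (R : realType) (Y : topologicalType).

Definition cts_pred : {pred Y -> R} := mem [set z : Y -> R | continuous z].

Definition cts_Sub (z : Y -> R) (zP : z \in cts_pred) : continuousType Y R :=
  mkcts (set_mem zP).

Lemma cts_rect (K : continuousType Y R -> Type) :
  (forall z (zP : z \in cts_pred), K (cts_Sub zP)) -> forall u, K u.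
Proof.
move=> Ksub [z [[zc]]].
have zP : z \in cts_pred by rewrite inE.
have -> : zc = set_mem zP by exact: Prop_irrelevance.
exact: Ksub.
Qed.

Lemma cts_SubK z (zP : z \in cts_pred) : cts_Sub zP = z :> (Y -> R).
Proof. by []. Qed.

HB.instance Definition _ :=
  isSub.Build (Y -> R) _ (continuousType Y R) cts_rect cts_SubK.

Lemma cts_submod_closed : submod_closed cts_pred.
Proof.
split; first by rewrite inE /= => y; exact: cvg_cst.
move=> a z w; rewrite !inE /= => zc wc y.
by apply: cvgD; [apply: cvgM; [exact: cvg_cst | exact: zc] | exact: wc].
Qed.

HB.instance Definition _ :=
  GRing.isSubmodClosed.Build R (Y -> R) cts_pred cts_submod_closed.

HB.instance Definition _ :=
  [SubChoice_isSubLmodule of continuousType Y R by <:].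

Lemma funrneg_continuous (z : continuousType Y R) :
  continuous ((z : Y -> R)^\-).
Proof.
move=> y; apply: (@continuous_max _ _ (fun y => - z y) (cst 0)).
  by apply: cvgN; exact: cts_fun.
exact: cvg_cst.
Qed.

Definition negpart (z : continuousType Y R) : continuousType Y R :=
  mkcts (@funrneg_continuous z).

(* When Y is compact this set is bounded; it is empty when Y is, and then
   [sup set0 = 0] is the norm of the only element of C(Y). *)
Definition supnorm (z : continuousType Y R) : R :=
  sup [set `|z y| | y in [set: Y]].

End continuous_functions.

(* Y with its Borel sigma-algebra. Measurable types of the library are pointed,
   whence the argument y0, on which nothing else depends. *)
Definition borel (Y : topologicalType) (y0 : Y) : Type := Y.

Section borel.
Variables (Y : topologicalType) (y0 : Y).

HB.instance Definition _ := Choice.on (borel y0).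
HB.instance Definition _ := isPointed.Build (borel y0) y0.

Lemma borelC (B : set (borel y0)) :
  <<s @open Y >> B -> <<s @open Y >> (~` B).
Proof. by move=> mB; rewrite -setTD; exact: sigma_algebraCD. Qed.

HB.instance Definition _ := @isMeasurable.Build (sigma_display (@open Y))
  (borel y0) <<s @open Y >> (@sigma_algebra0 Y setT (@open Y)) borelC
  (@sigma_algebra_bigcup Y setT (@open Y)).

End borel.

Section radon.
Variables (R : realType) (Y : topologicalType).

(* As Y need not be Hausdorff, a compact set need not be Borel. *)
Definition is_radon (y0 : Y) (mu : {measure set (borel y0) -> \bar R}) : Prop :=
  [/\ forall K : set Y, compact K -> measurable (K : set (borel y0)) ->
        (mu K < +oo)%E,
      forall B : set (borel y0), measurable B ->
        mu B = ereal_inf [set mu U | U in [set U : set Y | open U /\ B `<=` U]]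
    & forall B : set (borel y0), measurable B ->
        mu B = ereal_sup [set mu K | K in [set K : set Y |
          [/\ compact K, measurable (K : set (borel y0)) & K `<=` B]]]].

(* Positive Radon measures on Y. The first constructor is the zero measure on
   the empty space, which is not a measurable type of the library. *)
Variant radon_measure : Type :=
  | RadonEmpty of (Y -> False)
  | RadonMeasure (y0 : Y) (mu : {measure set (borel y0) -> \bar R})
      of is_radon mu.

Definition pairing (m : radon_measure) (z : continuousType Y R) : R :=
  match m with
  | RadonEmpty _ => 0
  | RadonMeasure _ mu _ => \int[mu]_y z y
  end.

End radon.

(* Main.v *)
Require Import Defs.
From HB Require Import structures.
From mathcomp Require Import all_boot all_order all_algebra.
From mathcomp Require Import all_classical all_reals all_analysis.
From mathcomp Require Import ring lra.

Set Implicit Arguments.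
Unset Strict Implicit.
Unset Printing Implicit Defensive.

Import Order.TTheory GRing.Theory Num.Theory.
Import numFieldNormedType.Exports.

Local Open Scope classical_set_scope.
Local Open Scope ring_scope.

(** If [f] is integration of [A xi] against [mu] and [f xi = -1], then [A xi] is
bounded below by minus the norm of its negative part, so this norm is at least
the inverse of the total mass of [mu].

Conversely, (a) says by homogeneity that [f xi <= M * s] whenever
[A xi <= s] pointwise with [s >= 0], where [M = 1 / e]. In a Hausdorff space
the Hahn-Banach theorem would extend [f] to a positive functional on C(Y), and
the Riesz theorem would represent it. Here points of [Y] need not be
separated, so the continuous functions do not determine a Borel measure, and a
finitely additive extension chosen without care need not be regular. Both
difficulties are met at once by extending [f] to the indicators of closed sets
in place of the continuous functions, making the values on closed sets as
large as possible.

Call [lam : set Y -> R] feasible when the bound [M] persists on the cone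
generated by the pairs [(A xi, f xi)] and [(\1_F, lam F)] for closed [F].
Zero is feasible, and Zorn's lemma gives a maximal feasible [lam]
([exists_maximal]). Maximality has two consequences. No value [lam F]
can be raised, so [\1_F] has majorants of the form [s - k], with [k] in the
cone, whose value is almost [lam F] ([maximal_saturated]). Hence inequalities between
functions of the cone imply inequalities between their values ([cone_mono]),
and [lam] is monotone and modular on closed sets. It also gives regularity: the
complement of [F] contains closed sets of almost the complementary mass
([maximal_tight]), namely superlevel sets of the functions in the cone, which
are upper semicontinuous.

A monotone, modular and tight set function on the closed subsets of a compact
space extends to a regular Borel measure, by Caratheodory's construction from
the outer measure defined by open sets ([tight_charge_extension]); compactness
gives countable subadditivity. Finally [A xi] lies below a step function made
of closed superlevel sets, up to a small constant, so [cone_mono] bounds [f xi]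
by the integral of [A xi] ([maximal_integral]); applied to [- xi] this gives
equality. *)

(** * The cone generated by the functional and the closed sets *)

Section generated_cone.
Variables (R : realType) (X : lmodType R) (Y : topologicalType).
Variables (f : {scalar X}) (A : {linear X -> continuousType Y R}).
Implicit Types (lam : set Y -> R) (h g : Y -> R) (t s c : R) (F : set Y).

(** [cone lam h t]: the pair [(h, t)] is a sum of some [(A xi, f xi)] and of
    nonnegative multiples of pairs [(\1_F, lam F)] with [F] closed. A function
    may have several values [t]; that it has only one when [lam] is maximal
    follows from [cone_mono] below. *)
Inductive cone lam : (Y -> R) -> R -> Prop :=
| cone_image xi : cone lam (A xi) (f xi)
| cone_closed F c h t : closed F -> 0 <= c -> cone lam h t ->
    cone lam (fun y => h y + c * \1_F y) (t + c * lam F).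

Lemma cone_eq lam h g t s :
  cone lam h t -> h =1 g -> t = s -> cone lam g s.
Proof. by move=> + /funext <- <-. Qed.

Lemma linear_evalD xi zeta y : A (xi + zeta) y = A xi y + A zeta y.
Proof. by rewrite linearD. Qed.

Lemma linear_evalZ c xi y : A (c *: xi) y = c * A xi y.
Proof. by rewrite linearZ. Qed.

Lemma cone0 lam : cone lam (cst 0) 0.
Proof.
apply: cone_eq (cone_image lam 0) _ _ => [y|]; last exact: linear0.
by rewrite linear0.
Qed.

Lemma coneD lam h g t s :
  cone lam h t -> cone lam g s -> cone lam (h \+ g) (t + s).
Proof.
move=> coneh; elim: coneh g s => [xi|F c {}h {}t cF c0 _ IH] g s.
  elim=> [zeta|F c {}g {}s cF c0 _ IH].
    apply: cone_eq (cone_image lam (xi + zeta)) _ _ => [y|].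
      exact: linear_evalD.
    by rewrite linearD.
  by apply: cone_eq (cone_closed cF c0 IH) _ _ => [y|] /=; rewrite addrA.
move=> coneg; apply: cone_eq (cone_closed cF c0 (IH _ _ coneg)) _ _ => [y|] /=;
  by rewrite addrAC.
Qed.

Lemma coneZ lam c h t : 0 <= c -> cone lam h t ->
  cone lam (fun y => c * h y) (c * t).
Proof.
move=> c0; elim=> [xi|F d {}h {}t cF d0 _ IH].
  apply: cone_eq (cone_image lam (c *: xi)) _ _ => [y|].
    exact: linear_evalZ.
  by rewrite linearZ.
by apply: cone_eq (cone_closed cF (mulr_ge0 c0 d0) IH) _ _ => [y|] /=; ring.
Qed.

Lemma cone1 lam F c : closed F -> 0 <= c ->
  cone lam (fun y => c * \1_F y) (c * lam F).
Proof.
move=> cF c0; apply: cone_eq (cone_closed cF c0 (cone0 lam)) _ _ => [y|] /=;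
  by rewrite add0r.
Qed.

Lemma cone_cst lam c : 0 <= c -> cone lam (cst c) (c * lam setT).
Proof.
move=> c0; apply: cone_eq (cone1 lam closedT c0) _ erefl => y.
by rewrite indicT mulr1.
Qed.

(** Functions of the cone are upper semicontinuous, as sums of continuous
    functions and of indicators of closed sets with nonnegative weights. *)
Lemma closed_superlevel lam h t : cone lam h t ->
  forall a, closed [set y | a <= h y].
Proof.
elim=> [xi a|F c {}h {}t cF c0 _ IH a].
  have -> : [set y | a <= A xi y] = A xi @^-1` [set r | a <= r] by [].
  by apply: preimage_closed => [y _|]; [exact: cts_fun|exact: closed_ge].
have -> : [set y | a <= h y + c * \1_F y] =
    [set y | a <= h y] `|` (F `&` [set y | a - c <= h y]).
  apply/seteqP; split=> y /=.
    rewrite indicE; have [/set_mem Fy|Fy] := boolP (y \in F); last first.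
      by rewrite mulr0 addr0; left.
    by rewrite mulr1 => ah; right; split=> //; rewrite lerBlDr.
  rewrite indicE => -[ah|[Fy]]; first by rewrite ler_wpDr// mulr_ge0.
  by rewrite mem_set// mulr1 lerBlDr.
by apply: closedU; [exact: IH|exact: closedI].
Qed.

End generated_cone.

(** * Maximal feasible set functions *)

Section maximal_charge.
Variables (R : realType) (X : lmodType R) (Y : topologicalType).
Variables (f : {scalar X}) (A : {linear X -> continuousType Y R}) (M : R).
Implicit Types (lam : set Y -> R) (h g : Y -> R) (t s c : R) (F G : set Y).

Notation cone := (cone f A).

Definition feasible lam := forall h t s, cone lam h t -> 0 <= s ->
  (forall y, h y <= s) -> t <= M * s.

Definition le_closed lam lam' := forall F, closed F -> lam F <= lam' F.

Definition maximal lam := feasible lam /\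
  forall lam', feasible lam' -> le_closed lam lam' -> le_closed lam' lam.

(** Raising the values on closed sets raises the values on the cone, since the
    indicators enter with nonnegative weights. *)
Lemma cone_le lam lam' h t : le_closed lam lam' -> cone lam h t ->
  exists2 t', cone lam' h t' & t <= t'.
Proof.
move=> le_lam; elim=> [xi|F c {}h {}t cF c0 _ [t' coneh tt']].
  by exists (f xi); [exact: cone_image|].
exists (t' + c * lam' F); first exact: cone_closed.
by apply: lerD => //; apply: ler_wpM2l => //; exact: le_lam.
Qed.

Lemma feasible_le lam F : feasible lam -> closed F -> lam F <= M.
Proof.
move=> feas cF; rewrite -[leRHS]mulr1 -[leLHS]mul1r.
apply: feas (cone1 f A lam cF ler01) _ _ => [|y]; first exact: ler01.
by rewrite mul1r indicE; case: (_ \in _).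
Qed.

(** With value zero on every closed set, adding indicators increases the
    function and leaves its value, so only the bound on [f] matters. *)
Lemma feasible0 :
  (forall xi s, 0 <= s -> (forall y, A xi y <= s) -> f xi <= M * s) ->
  feasible (fun=> 0).
Proof.
move=> fM h t s coneh.
suff [xi -> Ah] : exists2 xi, t = f xi & forall y, A xi y <= h y.
  by move=> s0 hs; apply: fM => // y; exact: le_trans (Ah y) (hs y).
elim: coneh => [xi|F c {}h {}t _ c0 _ [xi -> Ah]]; exists xi => //.
  by rewrite mulr0 addr0.
by move=> y; apply: ler_wpDr => //; rewrite mulr_ge0.
Qed.

(** An element of the cone involves finitely many closed sets, so up to [e] its
    value for the supremum of a chain is already reached in the chain. *)
Lemma feasible_chain (C : set (set Y -> R)) : C !=set0 -> C `<=` feasible ->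
  total_on C le_closed ->
  exists2 lam, feasible lam & forall lam', C lam' -> le_closed lam' lam.
Proof.
move=> [lam0 Clam0] Cfeas Ctot.
pose C_ F := [set lam F | lam in C]; pose lam F := sup (C_ F).
have C_sup F : closed F -> has_sup (C_ F).
  move=> cF; split; first by exists (lam0 F), lam0.
  by exists M => _ [l /Cfeas feas <-]; exact: feasible_le.
exists lam; last first.
  move=> l Cl F cF; apply: ub_le_sup; first exact: (C_sup F cF).2.
  by exists l.
have approx h t : cone lam h t -> forall e, 0 < e ->
    exists l t', [/\ C l, cone l h t' & t <= t' + e].
  elim=> [xi e e0|F c {}h {}t cF c0 _ IH e e0].
    exists lam0, (f xi); split => //; first exact: cone_image.
    by rewrite lerDl ltW.
  have e20 : 0 < e / 2 by rewrite divr_gt0.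
  have c10 : 0 < c + 1 by rewrite ltr_wpDl.
  (* The divisor [c + 1] absorbs the weight [c] and stays positive at c = 0. *)
  have d0 : 0 < e / 2 / (c + 1) by rewrite divr_gt0.
  have [l1 [t1 [Cl1 cone1 tt1]]] := IH _ e20.
  have [_ [l2 Cl2 <-] lamF] := sup_adherent d0 (C_sup F cF).
  have {lamF} cF2 : c * lam F <= c * l2 F + e / 2.
    have : c * (e / 2 / (c + 1)) <= e / 2.
      by rewrite mulrCA ler_piMr ?(ltW e20)// ler_pdivrMr// mul1r lerDl.
    by have := ler_wpM2l c0 (ltW lamF); rewrite mulrBr -/(lam F); lra.
  have [l12|l21] := Ctot _ _ Cl1 Cl2.
    have [t2 cone2 t12] := cone_le l12 cone1.
    exists l2, (t2 + c * l2 F); split=> //; first exact: cone_closed.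
    by lra.
  exists l1, (t1 + c * l1 F); split=> //; first exact: cone_closed.
  by have := ler_wpM2l c0 (l21 F cF); lra.
move=> h t s coneh s0 hs; apply/ler_addgt0Pr => e e0.
have [l [t' [/Cfeas feas coneh' tt']]] := approx _ _ coneh _ e0.
by apply: le_trans tt' _; rewrite lerD2r; exact: feas coneh' s0 hs.
Qed.

Lemma exists_maximal lam0 : feasible lam0 -> exists lam, maximal lam.
Proof.
move=> feas0; pose T := {lam | feasible lam}.
pose le (l l' : T) := `[< le_closed (sval l) (sval l') >].
have [||C Ctot|[lam feas] max_lam] := @ZL_preorder T (exist _ _ feas0) le.
- by move=> l; apply/asboolP => F _.
- move=> l1 l2 l3 /asboolP l12 /asboolP l23; apply/asboolP => F cF.
  exact: le_trans (l12 F cF) (l23 F cF).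
- have [[l Cl]|C0] := pselect (C !=set0); last first.
    by exists (exist _ _ feas0) => l Cl; case: C0; exists l.
  have [|||lam feas lamub] := @feasible_chain [set sval l | l in C].
  + by exists (sval l), l.
  + by move=> _ [l' _ <-]; exact: (svalP l').
  + move=> _ _ [l1 Cl1 <-] [l2 Cl2 <-].
    by have [/asboolP|/asboolP] := Ctot _ _ Cl1 Cl2; [left|right].
  by exists (exist _ _ feas) => l' Cl'; apply/asboolP; apply: lamub; exists l'.
exists lam; split=> // lam' feas' le_lam.
by have /asboolP := max_lam (exist _ _ feas') (asboolT le_lam).
Qed.

Section maximal_theory.
Variables (lam : set Y -> R) (max_lam : maximal lam).

(** Raising the value of [F] by [e] breaks feasibility, so some element of the
    cone of the raised function violates the bound; it must contain [\1_F]
    with a positive weight, which can be normalised to 1. Thus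
    [s - k] is a majorant of [\1_F] whose natural value [M * s - q] exceeds
    [lam F] by less than [e]. *)
Lemma maximal_saturated F e : closed F -> 0 < e -> exists k q s,
  [/\ cone lam k q, 0 <= s, (forall y, \1_F y + k y <= s)
    & M * s - q < lam F + e].
Proof.
move=> cF e0; have [feas maxl] := max_lam.
pose lam' G := lam G + e * `[< G = F >]%:R.
have le_lam : le_closed lam lam'.
  by move=> G _; rewrite /lam' lerDl mulr_ge0// ltW.
(* Collect the multiples of [\1_F] in an element of the raised cone. *)
have decomp h t : cone lam' h t -> exists c k q, [/\ 0 <= c, cone lam k q,
    (forall y, h y = k y + c * \1_F y) & t = q + c * (lam F + e)].
  elim=> [xi|G d {}h {}t cG d0 _ [c [k [q [c0 conek hE tE]]]]].
    exists 0, (A xi), (f xi); split=> //; first exact: cone_image.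
      by move=> y; rewrite mul0r addr0.
    by rewrite mul0r addr0.
  have [GF|GF] := pselect (G = F).
    exists (c + d), k, q; split=> //; first exact: addr_ge0.
      move=> y; rewrite hE GF; ring.
    by rewrite tE /lam' GF asboolT// mulr1; ring.
  exists c, (fun y => k y + d * \1_G y), (q + d * lam G); split=> //.
  - exact: cone_closed.
  - by move=> y; rewrite hE; ring.
  - by rewrite tE /lam' asboolF// mulr0 addr0; ring.
have /existsNP[h /existsNP[t /existsNP[s]]] : ~ feasible lam'.
  move=> /maxl /(_ le_lam) /(_ _ cF); rewrite /lam' asboolT// mulr1.
  by rewrite gerDl leNgt e0.
move=> /not_implyP[/decomp[c [k [q [c0 conek hE tE]]]]].
move=> /not_implyP[s0 /not_implyP[hs /negP]]; rewrite -ltNge tE => Ms.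
have {c0} c0 : 0 < c.
  rewrite lt_neqAle c0 andbT; apply/eqP => c0'; move: Ms.
  rewrite -c0' mul0r addr0 ltNge (feas k)// => y.
  by have := hs y; rewrite hE -c0' mul0r addr0.
have ci0 : 0 <= c^-1 by rewrite invr_ge0 ltW.
exists (fun y => c^-1 * k y), (c^-1 * q), (c^-1 * s); split.
- exact: coneZ.
- exact: mulr_ge0.
- move=> y; rewrite -(ler_pM2l c0) mulrDr !mulrA mulfV ?gt_eqF// !mul1r addrC.
  by rewrite -hE.
rewrite -(ltr_pM2l c0) mulrBr mulrCA !mulrA mulfV ?gt_eqF// !mul1r ltrBlDl.
by rewrite mulfK ?gt_eqF.
Qed.

(** The previous majorants, added up over an element [(g, r)] of the cone: [- g]
    is almost in the cone with value [- r], up to a constant [s] that costs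
    [M * s]. The functions [A xi] have exact opposites. *)
Lemma cone_opp_approx g r : cone lam g r -> forall e, 0 < e -> exists k q s,
  [/\ cone lam k q, 0 <= s, (forall y, g y + k y <= s) & M * s - q <= r + e].
Proof.
elim=> [xi e e0|F c {}g {}r cF c0 _ IH e e0].
  exists (A (- xi)), (f (- xi)), 0; split => //; first exact: cone_image.
    by move=> y; rewrite -linear_evalD subrr linear0.
  by rewrite linearN mulr0 opprK add0r lerDl ltW.
have e20 : 0 < e / 2 by rewrite divr_gt0.
have c10 : 0 < c + 1 by rewrite ltr_wpDl.
have d0 : 0 < e / 2 / (c + 1) by rewrite divr_gt0.
have [k1 [q1 [s1 [cone1 s10 gk1 Ms1]]]] := IH _ e20.
have [k2 [q2 [s2 [cone2 s20 Fk2 Ms2]]]] := maximal_saturated cF d0.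
exists (k1 \+ (fun y => c * k2 y)), (q1 + c * q2), (s1 + c * s2); split.
- by apply: coneD => //; exact: coneZ.
- by rewrite addr_ge0// mulr_ge0.
- move=> y /=; have := ler_wpM2l c0 (Fk2 y); have := gk1 y; rewrite mulrDr.
  lra.
- have : c * (e / 2 / (c + 1)) <= e / 2.
    by rewrite mulrCA ler_piMr ?(ltW e20)// ler_pdivrMr// mul1r lerDl.
  by have := ler_wpM2l c0 (ltW Ms2); lra.
Qed.

(** If [h <= g], then [h] plus an approximate opposite of [g] is at most the
    constant [s], and feasibility applies to this sum. *)
Lemma cone_mono h g t r : cone lam h t -> cone lam g r ->
  (forall y, h y <= g y) -> t <= r.
Proof.
move=> coneh coneg hg; apply/ler_addgt0Pr => e e0.
have [k [q [s [conek s0 gks Msq]]]] := cone_opp_approx coneg e0.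
apply: le_trans _ Msq; rewrite lerBrDr.
apply: max_lam.1 (coneD coneh conek) s0 _.
by move=> y /=; apply: le_trans (gks y); rewrite lerD2r.
Qed.

(** Take a majorant [s - k] of [\1_F] of almost minimal value, and let [G] be
    the set where it is at most [1 - d]. This is disjoint from [F], where the
    majorant is at least 1; it is closed because [k] is upper semicontinuous;
    and off [G] the majorant exceeds [1 - d], so its value is at least about
    the mass that [G] leaves free. The choice of [d] makes the loss
    [d * lam setT] at most [e / 2]. *)
Lemma maximal_tight F e : closed F -> 0 < e ->
  exists G, [/\ closed G, G `&` F = set0 & lam setT <= lam F + lam G + e].
Proof.
move=> cF e0; have m0 : 0 <= lam setT.
  rewrite -[leRHS]mul1r.
  apply: cone_mono (cone0 _ _ _) (cone_cst _ _ _ ler01) _.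
  by move=> y; exact: ler01.
have e20 : 0 < e / 2 by rewrite divr_gt0.
have m10 : 0 < lam setT + 1 by rewrite ltr_wpDl.
have mM : lam setT <= M by exact: feasible_le max_lam.1 closedT.
pose d := e / 2 / (lam setT + 1).
have d0 : 0 < d by rewrite !divr_gt0.
have dm : d * lam setT <= e / 2.
  by rewrite mulrAC -mulrA ler_piMr ?(ltW e20)// ler_pdivrMr// mul1r lerDl.
have [k [q [s [conek s0 Fks Msq]]]] := maximal_saturated cF e20.
pose G := [set y | s - 1 + d <= k y].
have cG : closed G by exact: closed_superlevel conek _.
exists G; split=> //.
  apply/seteqP; split=> // y [Gy Fy] /=; have := Fks y.
  rewrite indicE mem_set// /= => ks; move: Gy; rewrite /G /= => Gy; lra.
have lamG0 : 0 <= lam G.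
  rewrite -[leRHS]mul1r.
  apply: cone_mono (cone0 _ _ _) (cone1 _ _ _ cG ler01) _.
  by move=> y; rewrite mul1r.
have sd0 : 0 <= s + d by rewrite addr_ge0// ltW.
(* [k + 1 <= (s + d) + \1_G], in terms of values. *)
have bound : q + 1 * lam setT <= (s + d) * lam setT + 1 * lam G.
  apply: cone_mono (coneD conek (cone_cst _ _ _ ler01))
    (coneD (cone_cst _ _ _ sd0) (cone1 _ _ _ cG ler01)) _ => y /=.
  rewrite mul1r indicE; have [Gy|/negP Gy] := boolP (y \in G).
    have := Fks y; have : 0 <= \1_F y :> R by [].
    rewrite /=; lra.
  have : k y < s - 1 + d.
    by rewrite ltNge; apply/negP => Gy'; case: Gy; rewrite inE.
  rewrite /=; lra.
have := ler_wpM2r s0 mM; lra.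
Qed.

Lemma maximal0 : lam set0 = 0.
Proof.
apply/le_anti/andP; split; rewrite -[lam set0]mul1r.
  apply: cone_mono (cone1 _ _ _ closed0 ler01) (cone0 _ _ _) _ => y.
  by rewrite indic0 mulr0.
apply: cone_mono (cone0 _ _ _) (cone1 _ _ _ closed0 ler01) _ => y.
by rewrite indic0 mulr0.
Qed.

Lemma maximal_le F G : closed F -> closed G -> F `<=` G -> lam F <= lam G.
Proof.
move=> cF cG FG; rewrite -[leLHS]mul1r -[leRHS]mul1r.
apply: cone_mono (cone1 _ _ _ cF ler01) (cone1 _ _ _ cG ler01) _ => y.
by rewrite !mul1r !indicE; have [/set_mem/FG/mem_set->|_] := boolP (y \in F).
Qed.

Lemma maximal_modular F G : closed F -> closed G ->
  lam (F `|` G) + lam (F `&` G) = lam F + lam G.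
Proof.
move=> cF cG; have cU := closedU cF cG; have cI := closedI cF cG.
have cone2 H K (cH : closed H) (cK : closed K) :=
  coneD (cone1 f A lam cH ler01) (cone1 f A lam cK ler01).
have indicUI y : \1_(F `|` G) y + \1_(F `&` G) y = \1_F y + \1_G y :> R.
  rewrite !indicE in_setU in_setI.
  by case: (y \in F); case: (y \in G); rewrite /= ?addr0 ?add0r.
apply/le_anti/andP; split.
  have := @cone_mono _ _ _ _ (cone2 _ _ cU cI) (cone2 _ _ cF cG).
  by rewrite !mul1r; apply => y /=; rewrite !mul1r indicUI.
have := @cone_mono _ _ _ _ (cone2 _ _ cF cG) (cone2 _ _ cU cI).
by rewrite !mul1r; apply => y /=; rewrite !mul1r indicUI.
Qed.

End maximal_theory.
End maximal_charge.

(** * Extension of tight set functions to regular Borel measures *)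

Lemma closed_borel (Y : topologicalType) (y0 : Y) (F : set Y) : closed F ->
  measurable (F : set (borel y0)).
Proof.
move=> cF; rewrite -(setCK F); apply: measurableC.
by apply: sub_sigma_algebra; exact: closed_openC.
Qed.

Section tight_charge.
Variables (R : realType) (Y : topologicalType).
Implicit Types (lam : set Y -> R) (F G U V : set Y).

(** The conditions on closed sets that make a set function the restriction of a
    finite closed-regular measure. The last one says that the complement of [F]
    is approximated from inside by closed sets. *)
Record tight_charge lam : Prop := TightCharge {
  tight0 : lam set0 = 0;
  tight_le : forall F G, closed F -> closed G -> F `<=` G -> lam F <= lam G;
  tight_modular : forall F G, closed F -> closed G ->
    lam (F `|` G) + lam (F `&` G) = lam F + lam G;
  tight_approx : forall F e, closed F -> 0 < e ->
    exists G, [/\ closed G, G `&` F = set0 & lam setT <= lam F + lam G + e] }.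

Variables (lam : set Y -> R) (tlam : tight_charge lam).

Definition open_charge U : R := lam setT - lam (~` U).

(** On open sets this is [open_charge]; the formula has the shape of outer
    regularity, which the extension therefore inherits. *)
Definition outer_charge (B : set Y) : \bar R :=
  ereal_inf [set (open_charge U)%:E | U in [set U | open U /\ B `<=` U]].

Lemma open_charge_le U V : open U -> open V -> U `<=` V ->
  open_charge U <= open_charge V.
Proof.
move=> oU oV UV; rewrite lerD2l lerN2.
by apply: (tight_le tlam); [exact: open_closedC..|exact: subsetC].
Qed.

Lemma open_charge0 : open_charge set0 = 0.
Proof. by rewrite /open_charge setC0 subrr. Qed.

Lemma open_charge_ge0 U : open U -> 0 <= open_charge U.
Proof.
by move=> oU; rewrite -open_charge0; apply: open_charge_le => //; exact: open0.
Qed.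

Lemma open_chargeU U V : open U -> open V ->
  open_charge (U `|` V) <= open_charge U + open_charge V.
Proof.
move=> oU oV; have cU := open_closedC oU; have cV := open_closedC oV.
have := tight_modular tlam cU cV.
have := tight_le tlam (closedU cU cV) closedT (@subsetT _ _).
by rewrite /open_charge setCU; lra.
Qed.

Lemma le_open_charge F U : closed F -> open U -> F `<=` U ->
  lam F <= open_charge U.
Proof.
move=> cF oU FU; have cU := open_closedC oU.
have := tight_modular tlam cF cU.
have := tight_le tlam (closedU cF cU) closedT (@subsetT _ _).
have -> : F `&` ~` U = set0 by apply/seteqP; split=> // y [/FU].
by rewrite (tight0 tlam) /open_charge; lra.
Qed.

(** Tightness, read for the complement of [U]. *)
Lemma open_charge_approx U e : open U -> 0 < e ->
  exists G, [/\ closed G, G `<=` U & open_charge U <= lam G + e].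
Proof.
move=> oU e0; have [G [cG GU0 mle]] := tight_approx tlam (open_closedC oU) e0.
exists G; split=> //; last by rewrite /open_charge; lra.
move=> y Gy; apply: contrapT => Uy.
by have : (G `&` ~` U) y by []; rewrite GU0.
Qed.

Lemma outer_charge_open U : open U -> outer_charge U = (open_charge U)%:E.
Proof.
move=> oU; apply/eqP; rewrite eq_le; apply/andP; split.
  apply: ge_ereal_inf; exists (open_charge U)%:E => //.
  by exists U => //; split.
apply: le_ereal_inf_tmp => _ [V [oV UV] <-].
by rewrite lee_fin; exact: open_charge_le.
Qed.

Lemma outer_charge_le (B C : set Y) : B `<=` C ->
  (outer_charge B <= outer_charge C)%E.
Proof.
move=> BC; apply: le_ereal_inf_tmp => _ [V [oV CV] <-]; apply: ge_ereal_inf.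
exists (open_charge V)%:E => //; exists V => //.
by split=> //; exact: subset_trans CV.
Qed.

Lemma outer_charge_ge0 (B : set Y) : (0 <= outer_charge B)%E.
Proof.
by apply: le_ereal_inf_tmp => _ [V [oV _] <-]; rewrite lee_fin open_charge_ge0.
Qed.

Lemma outer_charge_fin (B : set Y) : outer_charge B \is a fin_num.
Proof.
rewrite ge0_fin_numE ?outer_charge_ge0//.
apply: le_lt_trans (outer_charge_le (@subsetT _ B)) _.
by rewrite outer_charge_open ?ltry//; exact: openT.
Qed.

Lemma outer_charge_approx (B : set Y) e : 0 < e ->
  exists U, [/\ open U, B `<=` U
    & ((open_charge U)%:E <= outer_charge B + e%:E)%E].
Proof.
move=> e0; have [_ [U [oU BU] <-] /ltW] :=
  lb_ereal_inf_adherent e0 (outer_charge_fin B).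
by move=> le_U; exists U.
Qed.

Hypothesis cY : compact [set: Y].

Lemma closed_sub_bigcup F (U : (set Y)^nat) : closed F ->
  (forall n, open (U n)) -> F `<=` \bigcup_n U n ->
  exists N, F `<=` \big[setU/set0]_(i < N) U i.
Proof.
move=> cF oU FU.
have kF : compact F by exact: subclosed_compact cF cY _.
have := (compact_near_coveringP F).1 kF nat \oo
  (fun N y => (\big[setU/set0]_(i < N) U i) y) _.
case=> [y /FU[n _ Uny]|N _ FN]; last by exists N; apply: FN => /=.
exists (U n, [set N | (n < N)%N]) => /=.
  by split; [exact: open_nbhs_nbhs|exists n.+1].
case=> z N /= [Unz nN]; rewrite -bigcup_mkord.
by exists n.
Qed.

(** A closed set that carries almost all the mass of a countable union of open
    sets is compact, hence covered by finitely many of them; this reduces the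
    countable case to the finite one. *)
Lemma outer_charge_sigma_subadditive : sigma_subadditive outer_charge.
Proof.
move=> B; apply/lee_addgt0Pr => e e0.
have e20 : 0 < e / 2 by rewrite divr_gt0.
have /choice[U UP] : forall n, exists U, [/\ open U, B n `<=` U &
    ((open_charge U)%:E <= outer_charge (B n) + (e / 2 / (2 ^ n.+1)%:R)%:E)%E].
  by move=> n; apply: outer_charge_approx; rewrite divr_gt0// ltr0n expn_gt0.
have oU n : open (U n) by case: (UP n).
have oUU : open (\bigcup_n U n) by exact: bigcup_open.
have [G [cG GU le_G]] := open_charge_approx oUU e20.
have [N GN] := closed_sub_bigcup cG oU GU.
have finU n : open (\big[setU/set0]_(i < n) U i) /\
    open_charge (\big[setU/set0]_(i < n) U i) <= \sum_(i < n) open_charge (U i).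
  elim: n => [|n [oUn IH]].
    by rewrite !big_ord0 open_charge0; split=> //; exact: open0.
  rewrite !big_ord_recr /=; split; first exact: openU.
  by apply: le_trans (open_chargeU oUn (oU n)) _; rewrite lerD2r.
apply: (@le_trans _ _ (open_charge (\bigcup_n U n))%:E).
  apply: ge_ereal_inf; exists (open_charge (\bigcup_n U n))%:E => //.
  exists (\bigcup_n U n) => //; split=> // y [n _ Bny].
  by exists n => //; case: (UP n) => _ + _; exact.
apply: (@le_trans _ _ ((\sum_(i < N) open_charge (U i))%:E + (e / 2)%:E)%E).
  rewrite -EFinD lee_fin; apply: le_trans le_G _; rewrite lerD2r.
  have [oN /(le_trans _)] := finU N; apply; exact: le_open_charge.
rewrite [e in leRHS]splitr EFinD addeA leeD2r//.
apply: le_trans (epsilon_trick _ _ (ltW e20)); last first.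
  by move=> n; exact: outer_charge_ge0.
apply: (@le_trans _ _ (\sum_(0 <= i <oo) (open_charge (U i))%:E)%E).
  rewrite -sumEFin -(big_mkord xpredT (fun i => (open_charge (U i))%:E)).
  by apply: nneseries_lim_ge => n _ _; rewrite lee_fin open_charge_ge0.
apply: lee_nneseries => n; first by move=> _ _; rewrite lee_fin open_charge_ge0.
by move=> _; case: (UP n).
Qed.

Lemma outer_charge0 : outer_charge set0 = 0%E.
Proof. by rewrite outer_charge_open ?open_charge0//; exact: open0. Qed.

(** It suffices to split open sets [V]. Choose a closed [G] that carries almost
    all of [V] inside [U]; then [V] minus [G] is open, contains the part of [V]
    outside [U], and has exactly the mass of [V] minus that of [G]. *)
Lemma open_caratheodory U : open U -> outer_charge.-caratheodory U.
Proof.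
pose mu : {outer_measure set Y -> \bar R} := HB.pack outer_charge
  (isOuterMeasure.Build R Y outer_charge outer_charge0 outer_charge_ge0
    outer_charge_le outer_charge_sigma_subadditive).
move=> oU; apply: (@le_caratheodory_measurable R Y mu) => X /=.
rewrite -[X in (X <= _)%E]/
  (outer_charge (X `&` U) + outer_charge (X `&` ~` U))%E.
apply: le_ereal_inf_tmp => _ [V [oV XV] <-].
apply/lee_addgt0Pr => e e0.
have oVU := openI oV oU.
have [G [cG GVU le_G]] := open_charge_approx oVU e0.
have oVG : open (V `&` ~` G) by apply: openI => //; exact: closed_openC.
apply: (@le_trans _ _
    ((open_charge (V `&` U))%:E + (open_charge (V `&` ~` G))%:E)%E).
  rewrite -!outer_charge_open// leeD//; apply: outer_charge_le.
    exact: setSI.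
  move=> y [Xy Uy]; split; [exact: XV|by move=> /GVU[]].
rewrite -!EFinD lee_fin.
have := tight_modular tlam (open_closedC oV) cG.
have -> : ~` V `&` G = set0 by apply/seteqP; split=> // y [Vy /GVU[]].
rewrite (tight0 tlam) /open_charge !setCI setCK.
by move: le_G; rewrite /open_charge setCI; lra.
Qed.

(** Inner regularity follows from outer regularity of the complement, because
    the complement of an open set is closed, hence compact. *)
Theorem tight_charge_extension (y0 : Y) :
  exists2 mu : {measure set (borel y0) -> \bar R}, is_radon mu &
    forall F, closed F -> mu F = (lam F)%:E.
Proof.
pose nu : {outer_measure set (borel y0) -> \bar R} := HB.pack outer_charge
  (isOuterMeasure.Build R Y outer_charge outer_charge0 outer_charge_ge0
    outer_charge_le outer_charge_sigma_subadditive).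
have cara (B : set (borel y0)) : measurable B -> outer_charge.-caratheodory B.
  apply: smallest_sub; last exact: open_caratheodory.
  split=> [|C mC|C mC].
  - exact: (caratheodory_measurable_set0 nu).
  - by rewrite setTD; exact: (@caratheodory_measurable_setC _ _ nu).
  - exact: (@caratheodory_measurable_bigcup _ _ nu).
have sadd : semi_sigma_additive (outer_charge : set (borel y0) -> \bar R).
  move=> B mB tB mUB.
  apply: (@caratheodory_measure_sigma_additive R (borel y0) nu) => // [n|];
    exact: cara.
pose mu : {measure set (borel y0) -> \bar R} :=
  HB.pack (outer_charge : set (borel y0) -> \bar R)
    (isMeasure.Build _ (borel y0) R outer_charge outer_charge0
      outer_charge_ge0 sadd).
have splitT (B : set (borel y0)) : measurable B ->
    (lam setT)%:E = (outer_charge B + outer_charge (~` B))%E.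
  move=> /cara/(_ setT); rewrite !setTI => <-.
  rewrite outer_charge_open; last exact: openT.
  by rewrite /open_charge setCT (tight0 tlam) subr0.
have muE F : closed F -> outer_charge F = (lam F)%:E.
  move=> cF; have := splitT _ (closed_borel y0 cF).
  rewrite (outer_charge_open (closed_openC cF)) /open_charge setCK.
  rewrite -(fineK (outer_charge_fin F)) -EFinD.
  by case=> mE; congr EFin; lra.
exists mu => //; split.
- move=> K _ _; rewrite -[mu K]/(outer_charge K).
  by rewrite -ge0_fin_numE ?outer_charge_ge0// outer_charge_fin.
- move=> B mB; rewrite -[mu B]/(outer_charge B); congr ereal_inf.
  by apply/seteqP; split=> _ [U [oU BU] <-];
    exists U => //; rewrite -[mu U]/(outer_charge U) outer_charge_open.
- move=> B mB; apply/eqP; rewrite eq_le; apply/andP; split; last first.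
    by apply: ge_ereal_sup => _ [K [_ mK KB] <-]; exact: outer_charge_le.
  rewrite -[mu B]/(outer_charge B); apply/lee_addgt0Pr => e e0.
  have [U [oU BU le_U]] := outer_charge_approx (~` B) e0.
  have cU := open_closedC oU.
  apply: (@le_trans _ _ ((lam (~` U))%:E + e%:E)%E); last first.
    rewrite leeD2r//; apply: ereal_sup_ubound; exists (~` U); last exact: muE.
    split; first exact: subclosed_compact cU cY _.
      exact: closed_borel.
    by move=> y Uy; apply: contrapT => By; apply: Uy; exact: BU.
  move: le_U; have := splitT _ mB; rewrite /open_charge.
  rewrite -(fineK (outer_charge_fin B)) -(fineK (outer_charge_fin (~` B))).
  by rewrite -!EFinD !lee_fin => -[mE]; lra.
Qed.

End tight_charge.

(** * Integrals of continuous functions *)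

Section borel_integral.
Variables (R : realType) (Y : topologicalType) (cY : compact [set: Y]) (y0 : Y).
Variables (mu : {measure set (borel y0) -> \bar R}).
Hypothesis mu_fin : (mu setT < +oo)%E.
Implicit Types (z : continuousType Y R).

Lemma continuous_bound z : exists2 K, 0 <= K & forall y, `|z y| <= K.
Proof.
have : compact (z @` [set: Y]).
  apply: continuous_compact => //.
  by apply: continuous_subspaceT; exact: cts_fun.
move=> /compact_bounded[K [_ Kz]]; exists (`|K| + 1) => [|y].
  by rewrite addr_ge0.
by apply: Kz; [rewrite ltr_pwDr// ler_norm|exists y].
Qed.

Lemma continuous_integrable z :
  mu.-integrable setT (EFin \o (z : borel y0 -> R)).
Proof.
apply: measurable_bounded_integrable => //.
  apply: (measurability _ (measurable_realfun.RGenOpens.measurableE R)).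
  move=> _ [_ [a [b ->]] <-]; rewrite setTI; apply: sub_sigma_algebra.
  by have /continuousP := @cts_fun _ _ z; apply; exact: interval_open.
have [K _ Kz] := continuous_bound z.
exists K; split=> [|r Kr y _ /=]; first exact: num_real.
exact: le_trans (Kz y) (ltW Kr).
Qed.

Lemma cst_integrable r :
  mu.-integrable setT (EFin \o cst r : borel y0 -> \bar R).
Proof. exact: (continuous_integrable (mkcts (@cst_continuous Y R r))). Qed.

Lemma Rintegral_cstT r : \int[mu]_y r = r * fine (mu setT).
Proof. by rewrite Rintegral_cst. Qed.

Lemma step_integral (d : R) (F : (set Y)^nat) n : (forall k, closed (F k)) ->
  let g (y : borel y0) := \sum_(k < n) d * \1_(F k) y in
  mu.-integrable setT (EFin \o g) /\
  \int[mu]_y g y = \sum_(k < n) d * fine (mu (F k)).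
Proof.
move=> cF; elim: n => [|n [intg gE]] /=.
  rewrite big_ord0; under eq_fun do rewrite big_ord0.
  by split; [exact: cst_integrable|rewrite Rintegral_cstT mul0r].
have mF : measurable (F n : set (borel y0)) by exact: closed_borel.
have intI : mu.-integrable setT (EFin \o (\1_(F n) : borel y0 -> R)).
  apply: measurable_bounded_integrable => //.
  exists 1; split=> [|r r1 y _ /=]; first exact: num_real.
  by rewrite indicE; case: (_ \in _); rewrite ?normr1 ?normr0; lra.
have intdI : mu.-integrable setT (EFin \o (fun y : borel y0 => d * \1_(F n) y)).
  exact: (integrableZl measurableT d intI).
have -> : (fun y : borel y0 => \sum_(k < n.+1) d * \1_(F k) y) =
    (fun y => \sum_(k < n) d * \1_(F k) y + d * \1_(F n) y).
  by apply/funext => y; rewrite big_ord_recr.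
split; first exact: integrableD intg intdI.
rewrite RintegralD// RintegralZl// gE big_ord_recr /=; congr (_ + d * _).
by rewrite /Rintegral integral_indic// setIT.
Qed.

End borel_integral.

(** The sum is [d] times the number of [k < n] with [k * d <= u]: for
    [d > 0] and [u < n * d], this is the next multiple of [d] above [u]. *)
Lemma staircase (R : realFieldType) (d u : R) n : 0 <= d -> 0 <= u ->
  let s := \sum_(k < n) d * (k%:R * d <= u)%R%:R in
  (u <= n%:R * d -> u <= s) /\ s <= u + d.
Proof.
move=> d0 u0 /=; pose s m := \sum_(k < m) d * (k%:R * d <= u)%R%:R.
rewrite -/(s n).
(* The third bound carries the second one through the induction. *)
suff [lo hi _] : [/\ Num.min u (n%:R * d) <= s n, s n <= u + d
    & s n <= n%:R * d].
  by split=> // und; move: lo; rewrite min_l.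
rewrite {}/s; elim: n => [|n [lo hi1 hi2]].
  rewrite big_ord0 mul0r; split=> //; first by rewrite ge_min lexx orbT.
  exact: addr_ge0.
rewrite big_ord_recr /= -natr1 mulrDl mul1r.
have [le_u|lt_u] := leP (n%:R * d) u.
  rewrite mulr1; move: lo; rewrite min_r// => lo.
  by split; [rewrite ge_min lerD2r lo orbT|lra|lra].
rewrite mulr0 addr0; move: lo; rewrite min_l ?(ltW lt_u)// => lo.
by split; [rewrite ge_min lo|lra|lra].
Qed.

(** The staircase applied to the values of [A xi + K >= 0] is a combination of
    indicators of closed superlevel sets, for which [lam] and [mu] agree. It
    lies above [A xi + K], so [cone_mono] bounds [f xi + K * lam setT] by its
    integral, and it lies below [A xi + K + d]. *)
Lemma maximal_integral (R : realType) (X : lmodType R) (Y : topologicalType)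
    (cY : compact [set: Y]) (f : {scalar X})
    (A : {linear X -> continuousType Y R}) M lam (y0 : Y)
    (mu : {measure set (borel y0) -> \bar R}) :
  maximal f A M lam -> (forall F, closed F -> mu F = (lam F)%:E) ->
  forall xi, f xi = \int[mu]_y A xi y.
Proof.
move=> max_lam muE.
have muTE : mu setT = (lam setT)%:E by apply: muE; exact: closedT.
have muT : (mu setT < +oo)%E by rewrite muTE ltry.
have m0 : 0 <= lam setT by rewrite -lee_fin -muTE measure_ge0.
suff le_int xi : f xi <= \int[mu]_y A xi y.
  move=> xi; apply/le_anti; rewrite le_int /=.
  have := le_int (- xi); rewrite linearN.
  have -> : \int[mu]_y A (- xi) y = \int[mu]_y (-1 * A xi y).
    by apply: eq_Rintegral => y _; rewrite linearN mulN1r.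
  rewrite RintegralZl//; first lra.
  exact: continuous_integrable.
apply/ler_addgt0Pr => e e0.
have m10 : 0 < lam setT + 1 by rewrite ltr_wpDl.
pose d := e / (lam setT + 1).
have d0 : 0 < d by rewrite divr_gt0.
have dm : d * lam setT <= e.
  by rewrite /d mulrAC -mulrA ler_piMr ?(ltW e0)// ler_pdivrMr// mul1r lerDl.
have [K K0 Kz] := continuous_bound cY (A xi).
have u0 y : 0 <= A xi y + K by have := Kz y; rewrite ler_norml => /andP[]; lra.
pose n := (Num.truncn (2 * K / d)).+1.
have un y : A xi y + K <= n%:R * d.
  apply: (@le_trans _ _ (2 * K)).
    by have := Kz y; rewrite ler_norml => /andP[_]; lra.
  by rewrite -ler_pdivrMr// ltW// truncnS_gt.
pose F k := [set y | k%:R * d - K <= A xi y].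
have cF k : closed (F k) by exact: closed_superlevel (cone_image f A lam xi) _.
have FE k y : \1_(F k) y = (k%:R * d <= A xi y + K)%R%:R :> R.
  by rewrite indicE -lerBlDr mem_setE.
pose g y := \sum_(k < n) d * \1_(F k) y.
have coneg : cone f A lam g (\sum_(k < n) d * lam (F k)).
  rewrite /g; elim: n {un g} => [|n IH].
    rewrite big_ord0; apply: cone_eq (cone0 _ _ _) _ erefl => y.
    by rewrite big_ord0.
  rewrite big_ord_recr; apply: cone_eq (cone_closed (cF n) (ltW d0) IH) _ erefl.
  by move=> y; rewrite big_ord_recr.
have gE y : g y = \sum_(k < n) d * (k%:R * d <= A xi y + K)%R%:R.
  by apply: eq_bigr => k _; rewrite FE.
have le_g : f xi + K * lam setT <= \sum_(k < n) d * lam (F k).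
  apply: cone_mono max_lam _ _ _ _
    (coneD (cone_image f A lam xi) (cone_cst f A lam K0)) coneg _ => y /=.
  by rewrite gE; have [+ _] := staircase n (ltW d0) (u0 y); apply; exact: un.
have [intg intgE] := step_integral cY muT d n cF.
have intA := continuous_integrable cY muT (A xi).
have intK := cst_integrable cY muT (K + d).
have g_le : \int[mu]_y g y <= \int[mu]_y (A xi y + (K + d)).
  apply: (le_Rintegral measurableT intg (integrableD measurableT intA intK)).
  move=> y _; rewrite /= -[leLHS]/(g y) gE addrA.
  by have [] := staircase n (ltW d0) (u0 y).
move: g_le; rewrite intgE RintegralD//.
rewrite Rintegral_cstT muTE /= (eq_bigr (fun k : 'I_n => d * lam (F k))).
  lra.
by move=> k _; rewrite muE.
Qed.

(** * Condition (a) and the equivalence *)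

Section supremum_norm.
Variables (R : realType) (Y : topologicalType).
Implicit Types z : continuousType Y R.

Lemma supnorm_le z s : 0 <= s -> (forall y, `|z y| <= s) -> supnorm z <= s.
Proof.
move=> s0 zs; rewrite /supnorm.
have [Z|/set0P/negP/negPn/eqP->] :=
    pselect ([set `|z y| | y in [set: Y]] !=set0).
  by apply: ge_sup => // _ [y _ <-].
by rewrite sup0.
Qed.

Lemma le_supnorm z y : compact [set: Y] -> `|z y| <= supnorm z.
Proof.
move=> cY; have [K _ Kz] := continuous_bound cY z.
by apply: ub_le_sup; [exists K => _ [x _ <-]|exists y].
Qed.

End supremum_norm.

(** When [f xi > 0], rescaling [- xi] to [f = -1] turns the upper bound [s] of
    [A xi] into the bound [s / f xi] of a negative part. *)
Lemma functional_bound (R : realType) (X : lmodType R) (Y : topologicalType)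
    (f : {scalar X}) (A : {linear X -> continuousType Y R}) e : 0 < e ->
  (forall xi, f xi = -1 -> e <= supnorm (negpart (A xi))) ->
  forall xi s, 0 <= s -> (forall y, A xi y <= s) -> f xi <= e^-1 * s.
Proof.
move=> e0 le_e xi s s0 As.
have [fxi0|fxi0] := leP (f xi) 0.
  by apply: le_trans fxi0 _; rewrite mulr_ge0// invr_ge0 ltW.
pose t := f xi.
rewrite mulrC ler_pdivlMr// mulrC -ler_pdivlMr//.
have /le_trans : e <= supnorm (negpart (A (- t^-1 *: xi))).
  by apply: le_e; rewrite linearZ /= mulNr mulVf// gt_eqF.
apply; apply: supnorm_le => [|y]; first by rewrite divr_ge0// ltW.
have -> : negpart (A (- t^-1 *: xi)) y = Num.max (t^-1 * A xi y) 0.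
  by rewrite /negpart /= /mkcts /funrneg linear_evalZ mulNr opprK.
rewrite ger0_norm; last by rewrite le_max lexx orbT.
by rewrite ge_max divr_ge0// ?(ltW fxi0)// andbT mulrC ler_pM2r// invr_gt0.
Qed.

Theorem theorem5p4 (R : realType) (X : lmodType R) (Y : topologicalType)
    (cY : compact [set: Y]) (f : {scalar X})
    (A : {linear X -> continuousType Y R}) :
  (exists2 e : R, 0 < e &
     forall xi : X, f xi = -1 -> e <= supnorm (negpart (A xi))) <->
  (exists mu : radon_measure R Y, forall xi : X, f xi = pairing mu (A xi)).
Proof.
split=> [[e e0 le_e]|[[Y0|y0 mu mu_radon] fE]].
- have fM := functional_bound e0 le_e.
  have [lam max_lam] := exists_maximal (feasible0 fM).
  have [[y0 _]|/nonemptyPn Y0] := pselect ([set: Y] !=set0); last first.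
    have empty (y : Y) : False by have : [set: Y] y by []; rewrite Y0.
    exists (RadonEmpty R empty) => xi /=.
    have le0 zeta : f zeta <= 0.
      by rewrite -(mulr0 e^-1); apply: fM => // y; case: (empty y).
    by apply/le_anti; rewrite le0 /= -oppr_le0 -linearN le0.
  have tlam : tight_charge lam.
    split; [exact: maximal0 max_lam|exact: maximal_le max_lam|
      exact: maximal_modular max_lam|exact: maximal_tight max_lam].
  have [mu mu_radon muE] := tight_charge_extension tlam cY y0.
  exists (RadonMeasure mu_radon) => xi.
  exact: maximal_integral max_lam muE xi.
- by exists 1 => // xi; rewrite fE /= => /eqP; rewrite eq_sym oppr_eq0 oner_eq0.
have muT : (mu setT < +oo)%E by have [+ _ _] := mu_radon; exact.
have m0 : 0 <= fine (mu setT) by rewrite fine_ge0// measure_ge0.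
have m10 : 0 < fine (mu setT) + 1 by rewrite ltr_wpDl.
(* The summand 1 keeps the divisor positive when [mu] is zero. *)
exists (fine (mu setT) + 1)^-1 => [|xi fxi]; first by rewrite invr_gt0.
set s := supnorm _.
have le_s y : - s <= A xi y.
  rewrite lerNl; apply: le_trans (le_supnorm (negpart (A xi)) y cY).
  rewrite (le_trans _ (ler_norm _))//.
  by rewrite /negpart /= /mkcts /funrneg le_max lexx.
have s0 : 0 <= s by exact: le_trans (normr_ge0 _) (le_supnorm _ y0 cY).
have : \int[mu]_y (- s) <= \int[mu]_y A xi y.
  apply: (le_Rintegral measurableT (cst_integrable cY muT (- s))
    (continuous_integrable cY muT (A xi))) => y _; exact: le_s.
rewrite -[leRHS]fE fxi Rintegral_cstT => le_m.
by rewrite -[leLHS]mul1r ler_pdivrMr// mulrDr mulr1; lra.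
Qed.
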